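(* For any $\alpha\in[0,180^\circ]$ and $\delta>0$, $$\widetilde{C}(\alpha,\delta)=\sup\{\overline{\dim}_{\mathrm M}(A) : A\subset\mathbb{R}^n \text{ for some } n,\ A \text{ is bounded},\ A \text{ does not contain any angle from } (\alpha-\delta,\alpha+\delta)\}.$$
   Context: A set $A\subset\mathbb{R}^n$ contains the angle $\alpha\in[0,180^\circ]$ if there exist distinct points $x,y,z\in A$ such that the angle between the vectors $y-x$ and $z-x$ is $\alpha$. Let $\dim$ denote Hausdorff dimension. For $\alpha\in[0,180^\circ]$ and $\delta>0$ define $$\widetilde{C}(\alpha,\delta)=\sup\{\dim(A) : A\subset\mathbb{R}^n \text{ for some } n,\ A \text{ does not contain any angle from } (\alpha-\delta,\alpha+\delta)\},$$ where $A$ is an arbitrary set and $n$ is not fixed; the supremum may be $\infty$. For a nonempty bounded $A\subset\mathbb{R}^n$ let $P(A,\varepsilon)$ be the greatest integer $k$ for which there exist $k$ pairwise disjoint closed balls of radius $\varepsilon$ with centers in $A$. The upper Minkowski dimension is $\overline{\dim}_{\mathrm M}(A)=\sup\{s:\limsup_{\varepsilon\to0+}P(A,\varepsilon)\varepsilon^s=\infty\}$. *)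

(* Defs.v *)
From HB Require Import structures.
From mathcomp Require Import all_boot all_order all_algebra.
From mathcomp Require Import all_classical all_reals all_analysis.
Set Implicit Arguments.
Unset Strict Implicit.
Unset Printing Implicit Defensive.
Import Order.TTheory GRing.Theory Num.Theory.
Import numFieldNormedType.Exports.
Local Open Scope classical_set_scope.
Local Open Scope ring_scope.

(* The library norm on 'rV[R]_n is the sup norm, so the Euclidean structure of
   R^n is introduced here. *)
Definition dotv (R : realType) (n : nat) (u v : 'rV[R]_n) : R :=
  \sum_(i < n) u 0 i * v 0 i.

Definition enorm (R : realType) (n : nat) (u : 'rV[R]_n) : R :=
  Num.sqrt (dotv u u).

Definition eball (R : realType) (n : nat) (x : 'rV[R]_n) (r : R) :
    set 'rV[R]_n :=
  closed_ball_ (@enorm R n) x r.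

Definition ebounded (R : realType) (n : nat) (A : set 'rV[R]_n) : Prop :=
  exists r : R, A `<=` eball 0 r.

(* In radians, with values in [0, pi] for nonzero u and v. *)
Definition angle (R : realType) (n : nat) (u v : 'rV[R]_n) : R :=
  acos (dotv u v / (enorm u * enorm v)).

Definition contains_angle (R : realType) (n : nat) (A : set 'rV[R]_n) (a : R) :
    Prop :=
  exists x y z : 'rV[R]_n,
    [/\ A x, A y & A z] /\ [/\ x <> y, x <> z & y <> z] /\
    angle (y - x) (z - x) = a.

Definition avoids_angles (R : realType) (n : nat) (A : set 'rV[R]_n)
    (alpha delta : R) : Prop :=
  forall a : R, alpha - delta < a < alpha + delta -> ~ contains_angle A a.

Definition diam (R : realType) (n : nat) (U : set 'rV[R]_n) : \bar R :=
  ereal_sup [set (enorm (x - y))%:E | x in U & y in U].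

(* diam(U)^s, with the usual conventions: 0 for empty U, and 0^0 = 1 for
   nonempty U, so that the 0-dimensional Hausdorff measure counts points. *)
Definition diam_pow (R : realType) (n : nat) (s : R) (U : set 'rV[R]_n) :
    \bar R :=
  if U == set0 then 0%E else poweR (diam U) s.

Definition hausdorff_premeasure (R : realType) (n : nat) (s eta : R)
    (A : set 'rV[R]_n) : \bar R :=
  ereal_inf [set (\sum_(0 <= i <oo) diam_pow s (U i))%E | U in
    [set U : nat -> set 'rV[R]_n |
      A `<=` \bigcup_i U i /\ forall i, (diam (U i) <= eta%:E)%E]].

(* The limit as eta -> 0+ is a supremum, since hausdorff_premeasure s eta A is
   nonincreasing in eta. *)
Definition hausdorff_measure (R : realType) (n : nat) (s : R)
    (A : set 'rV[R]_n) : \bar R :=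
  ereal_sup [set hausdorff_premeasure s eta A | eta in [set eta : R | 0 < eta]].

Definition hausdorff_dim (R : realType) (n : nat) (A : set 'rV[R]_n) : \bar R :=
  ereal_inf [set s%:E | s in
    [set s : R | 0 <= s /\ hausdorff_measure s A = 0%E]].

Definition packable (R : realType) (n : nat) (A : set 'rV[R]_n) (eps : R)
    (k : nat) : Prop :=
  exists c : 'I_k -> 'rV[R]_n,
    (forall i, A (c i)) /\ trivIset setT (fun i => eball (c i) eps).

(* For bounded A and eps > 0 the admissible k are bounded, so this supremum is
   the greatest one (packing_number_greatest). *)
Definition packing_number (R : realType) (n : nat) (A : set 'rV[R]_n)
    (eps : R) : \bar R :=
  ereal_sup [set (k%:R)%:E | k in [set k : nat | packable A eps k]].

Lemma packing_number_greatest (R : realType) (n : nat) (A : set 'rV[R]_n)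
    (eps : R) (k : nat) :
  packable A eps k -> (forall m, packable A eps m -> (m <= k)%N) ->
  packing_number A eps = (k%:R)%:E.
Proof.
move=> hk kmax; apply/eqP; rewrite eq_le; apply/andP; split.
  by apply: ge_ereal_sup => _ [m hm <-]; rewrite lee_fin ler_nat kmax.
by apply: ereal_sup_ubound; exists k.
Qed.

(* s ranges over all reals, so that finite nonempty sets get dimension 0. *)
Definition upper_minkowski_dim (R : realType) (n : nat) (A : set 'rV[R]_n) :
    \bar R :=
  ereal_sup [set s%:E | s in
    [set s : R |
      limf_esup (fun eps : R => (packing_number A eps * (eps `^ s)%:E)%E)
        0^'+ = +oo%E]].

Definition Ctilde (R : realType) (alpha delta : R) : \bar R :=
  ereal_sup [set d | exists (n : nat) (A : set 'rV[R]_n),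
    avoids_angles A alpha delta /\ d = hausdorff_dim A].

(* Main.v *)
Require Import Defs.
From HB Require Import structures.
From mathcomp Require Import all_boot all_order all_algebra.
From mathcomp Require Import all_classical all_reals all_analysis.
From mathcomp Require Import ring lra.
Import Order.TTheory GRing.Theory Num.Theory.
Import numFieldNormedType.Exports.
Local Open Scope classical_set_scope.
Local Open Scope ring_scope.

(** A Hausdorff cover argument gives [<=]: intersecting [A] with the balls
    [eball 0 k], a maximal packing by [eps]-balls yields a cover by balls of
    radius [2 eps], so [H^t] vanishes for [t] above the Minkowski dimensions of
    the pieces, and null sets are stable under countable unions.

    For [>=], suppose [P(A,eps) eps^s] is unbounded and fix [q > 0].  Some ball
    [B(x,r)] is such that [A `&` B(x,r)] has no finite cover by balls of radii
    [r_i] in [[q r, r/2]] with [\sum_i r_i^s <= r^s]: otherwise iterating these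
    covers down to scale [eps] would bound [P(A,eps) eps^s].  Take such balls
    for [q = 1/(m+1)], rescale them to the unit ball, and let [K] be the limit
    of the rescaled pieces of [A] along an ultrafilter.  Angles are similarity
    invariant and depend continuously on the points, so [K] avoids the same
    open interval of angles.  If [H^s(K) = 0], then [K] would be covered by
    open balls whose radii satisfy [\sum_i r_i^s <= 1], [r_i <= 1/2]; picking
    in the [m]-th piece a point outside those of the first [m] balls which
    have radius at least [1/(m+1)] and passing to the limit produces an
    uncovered point of [K]. *)

(** * Euclidean inner product, norm and angle *)

Section EuclideanSpace.
Context {R : realType} {n : nat}.
Implicit Types (u v w : 'rV[R]_n) (c : R).

Lemma dotvC u v : dotv u v = dotv v u.
Proof. by apply: eq_bigr => i _; rewrite mulrC. Qed.

Lemma dotvDl u v w : dotv (u + v) w = dotv u w + dotv v w.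
Proof. by rewrite -big_split; apply: eq_bigr => i _; rewrite mxE mulrDl. Qed.

Lemma dotvZl c u v : dotv (c *: u) v = c * dotv u v.
Proof. by rewrite /dotv mulr_sumr; apply: eq_bigr => i _; rewrite mxE mulrA. Qed.

Lemma dotvDr u v w : dotv w (u + v) = dotv w u + dotv w v.
Proof. by rewrite dotvC dotvDl !(dotvC w). Qed.

Lemma dotvZr c u v : dotv v (c *: u) = c * dotv v u.
Proof. by rewrite dotvC dotvZl dotvC. Qed.

Lemma dotv_ge0 u : 0 <= dotv u u.
Proof. by apply: sumr_ge0 => i _; rewrite -expr2 sqr_ge0. Qed.

Lemma dotv_eq0 u : dotv u u = 0 -> u = 0.
Proof.
move=> /eqP; rewrite psumr_eq0; last by move=> i _; rewrite -expr2 sqr_ge0.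
move=> /allP u0; apply/rowP => i; rewrite mxE.
by have := u0 i (mem_index_enum i); rewrite -expr2 sqrf_eq0 => /eqP.
Qed.

Lemma dotv_CauchySchwarz u v : dotv u v ^+ 2 <= dotv u u * dotv v v.
Proof.
have [v0|v_neq0] := eqVneq (dotv v v) 0.
  rewrite (dotv_eq0 _ v0) -(scale0r (0 : 'rV[R]_n)).
  by rewrite !dotvZr !mul0r expr0n mulr0.
have v_gt0 : 0 < dotv v v by rewrite lt_def v_neq0 dotv_ge0.
(* This square expands to [dotv v v] times the difference of the two sides of the claim. *)
have := dotv_ge0 (dotv v v *: u + (- dotv u v) *: v).
rewrite !(dotvDl, dotvDr, dotvZl, dotvZr) (dotvC v u) => h.
rewrite -subr_ge0 -(pmulr_rge0 _ v_gt0); apply: le_trans h _.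
by rewrite le_eqVlt; apply/orP; left; apply/eqP; ring.
Qed.

Lemma enorm_ge0 u : 0 <= enorm u.
Proof. exact: sqrtr_ge0. Qed.

Lemma sqr_enorm u : enorm u ^+ 2 = dotv u u.
Proof. by rewrite sqr_sqrtr ?dotv_ge0. Qed.

Lemma enorm_gt0 u : u <> 0 -> 0 < enorm u.
Proof.
move=> u0; rewrite lt_def enorm_ge0 andbT; apply/eqP => e0; apply: u0.
by apply: dotv_eq0; rewrite -sqr_enorm e0 expr0n.
Qed.

Lemma enorm0 : enorm (0 : 'rV[R]_n) = 0.
Proof. by rewrite /enorm -(scale0r (0 : 'rV[R]_n)) dotvZl mul0r sqrtr0. Qed.

Lemma enormZ c u : 0 <= c -> enorm (c *: u) = c * enorm u.
Proof.
move=> c0; rewrite /enorm dotvZl dotvZr mulrA -expr2 sqrtrM ?sqr_ge0//.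
by rewrite sqrtr_sqr ger0_norm.
Qed.

Lemma enormN u : enorm (- u) = enorm u.
Proof.
by rewrite /enorm -scaleN1r dotvZl dotvZr mulrA mulN1r opprK mul1r.
Qed.

Lemma enormBC u v : enorm (u - v) = enorm (v - u).
Proof. by rewrite -enormN opprB. Qed.

Lemma dotv_le_enorm u v : `|dotv u v| <= enorm u * enorm v.
Proof.
rewrite -(@ler_pXn2r _ 2%N)// ?nnegrE ?mulr_ge0 ?enorm_ge0//.
by rewrite real_normK ?num_real// exprMn !sqr_enorm dotv_CauchySchwarz.
Qed.

Lemma enormD u v : enorm (u + v) <= enorm u + enorm v.
Proof.
rewrite -(@ler_pXn2r _ 2%N)// ?nnegrE ?addr_ge0 ?enorm_ge0//.
rewrite sqrrD !sqr_enorm !(dotvDl, dotvDr) (dotvC v u).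
have := le_trans (ler_norm _) (dotv_le_enorm u v); lra.
Qed.

Lemma enorm_entry u i : `|u 0 i| <= enorm u.
Proof.
rewrite -(@ler_pXn2r _ 2%N)// ?nnegrE ?enorm_ge0//.
rewrite real_normK ?num_real// sqr_enorm /dotv (bigD1 i)//= -expr2 lerDl.
by apply: sumr_ge0 => j _; rewrite -expr2 sqr_ge0.
Qed.

Lemma cos_angle_itv u v : -1 <= dotv u v / (enorm u * enorm v) <= 1.
Proof.
(* If one vector is zero, the convention [0^-1 = 0] makes the quotient [0], which is in range. *)
have [p0|p0] := eqVneq (enorm u * enorm v) 0.
  by rewrite p0 invr0 mulr0; lra.
have p_gt0 : 0 < enorm u * enorm v by rewrite lt_def p0 mulr_ge0 ?enorm_ge0.
have := dotv_le_enorm u v; rewrite ler_norml => /andP[h1 h2].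
by rewrite ler_pdivlMr// ler_pdivrMr// mulN1r mul1r h1 h2.
Qed.

Lemma angleZ c u v : 0 < c -> angle (c *: u) (c *: v) = angle u v.
Proof.
move=> c0; rewrite /angle dotvZl dotvZr !enormZ ?(ltW c0)// mulrA.
by rewrite (mulrACA c) -mulf_div divff ?mul1r// mulf_neq0 ?gt_eqF.
Qed.

End EuclideanSpace.

(** * Limits of points and angles along a filter *)

Lemma ultra_fmap {T U : Type} (f : T -> U) (F : set_system T) :
  UltraFilter F -> UltraFilter (f @ F).
Proof.
move=> UF; split; first exact: fmap_proper_filter.
move=> G GF sFG; rewrite eqEsubset; split => // A GA.
have [//|FnA] := in_ultra_setVsetC (f @^-1` A) UF.
have /filter_ex[? []] // : G (A `&` ~` A) by apply: filterI => //; exact: sFG.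
Qed.

Section CoordinatewiseConvergence.
Context {R : realType} {n : nat}.

(** Stated by coordinates, so that limits of [dotv] and [enorm] come from limits of real sums and
    products. *)
Definition coord_cvg (F : set_system nat) (f : nat -> 'rV[R]_n) (x : 'rV[R]_n) :=
  forall i, (fun m => f m 0 i) @ F --> x 0 i.

Context (F : set_system nat) {FF : ProperFilter F}.
Implicit Types (f g : nat -> 'rV[R]_n) (x y : 'rV[R]_n).

Lemma coord_cvg_cst x : coord_cvg F (fun=> x) x.
Proof. by move=> i; exact: cvg_cst. Qed.

Lemma coord_cvgB {f g x y} : coord_cvg F f x -> coord_cvg F g y ->
  coord_cvg F (fun m => f m - g m) (x - y).
Proof.
move=> fx gy i; rewrite !mxE.
under eq_cvg do rewrite !mxE.
exact: cvgB (fx i) (gy i).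
Qed.

Lemma cvg_dotv {f g x y} : coord_cvg F f x -> coord_cvg F g y ->
  (fun m => dotv (f m) (g m)) @ F --> dotv x y.
Proof.
move=> fx gy; rewrite /dotv.
elim: (index_enum _) => [|i s IH].
  rewrite big_nil; under eq_cvg do rewrite big_nil; exact: cvg_cst.
rewrite big_cons; under eq_cvg do rewrite big_cons.
by apply: cvgD IH; exact: cvgM.
Qed.

Lemma cvg_enorm {f x} : coord_cvg F f x -> (fun m => enorm (f m)) @ F --> enorm x.
Proof.
move=> fx; apply: (@cvg_comp _ _ _ (fun m => dotv (f m) (f m))).
  exact: (cvg_dotv fx fx).
exact: sqrt_continuous.
Qed.

(** Every coordinate stays in the compact segment [[-r, r]], where an ultrafilter converges; this
    replaces extracting a subsequence common to all coordinates. *)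
Lemma coord_cvg_ultra f (r : R) : UltraFilter F ->
  (forall m, enorm (f m) <= r) -> exists x, coord_cvg F f x.
Proof.
move=> UF fr.
have cv i : exists l : R, (fun m => f m 0 i) @ F --> l.
  have := @segment_compact R (- r) r; rewrite compact_ultra.
  move=> /(_ ((fun m => f m 0 i) @ F)) [].
  - exact: ultra_fmap.
  - apply: (@filterE _ F) => m /=; rewrite in_itv/= -ler_norml.
    exact: le_trans (enorm_entry _ _) (fr m).
  - by move=> l [_ ?]; exists l.
have [l lP] := choice cv.
by exists (\row_i l i) => i; rewrite mxE; exact: lP.
Qed.

(* [continuous_acos] excludes the end points, that is, the angles 0 and pi. *)
Lemma acos_near (c : nat -> R) (c0 a b : R) :
  (forall m, -1 <= c m <= 1) -> -1 <= c0 <= 1 -> c @ F --> c0 ->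
  a < acos c0 < b -> \forall m \near F, a < acos (c m) < b.
Proof.
move=> c1 c01 cc0 /andP[ac cb].
have cin m : c m \in `[-1, 1] by rewrite in_itv/= c1.
have c0in : c0 \in `[-1, 1] by rewrite in_itv/= c01.
have acin m : acos (c m) \in `[0, pi].
  by rewrite in_itv/= acos_ge0// acos_lepi.
have ac0in : acos c0 \in `[0, pi].
  by rewrite in_itv/= acos_ge0// acos_lepi.
have lo : \forall m \near F, a < acos (c m).
  (* Cosine is decreasing on [[0, pi]] only; a negative [a] is below every value of [acos]. *)
  have [a0|a0] := ltP a 0.
    by apply: nearW => m; apply: lt_le_trans a0 _; rewrite acos_ge0.
  have ain : a \in `[0, pi].
    by rewrite in_itv/= a0/= (le_trans (ltW ac))// acos_lepi.
  have : c0 < cos a by rewrite -[c0]acosK// ltr_cos.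
  move=> /(cvgr_lt c0 cc0); apply: filterS => m.
  by rewrite -{1}[c m]acosK// ltr_cos.
have hi : \forall m \near F, acos (c m) < b.
  have [b0|b0] := ltP pi b.
    by apply: nearW => m; apply: le_lt_trans b0; rewrite acos_lepi.
  have bin : b \in `[0, pi].
    by rewrite in_itv/= b0 andbT (le_trans _ (ltW cb))// acos_ge0.
  have : cos b < c0 by rewrite -[c0]acosK// ltr_cos.
  move=> /(cvgr_gt c0 cc0); apply: filterS => m.
  by rewrite -{1}[c m]acosK// ltr_cos.
by apply: filterS2 lo hi => m -> ->.
Qed.

Lemma angle_near f g x y (a b : R) : x <> 0 -> y <> 0 ->
  coord_cvg F f x -> coord_cvg F g y -> a < angle x y < b ->
  \forall m \near F, a < angle (f m) (g m) < b.
Proof.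
move=> /enorm_gt0 x0 /enorm_gt0 y0 fx gy.
apply: acos_near => [m||]; [exact: cos_angle_itv|exact: cos_angle_itv|].
apply: cvgM; first exact: cvg_dotv.
apply: cvgV; first by rewrite mulf_neq0// gt_eqF.
by apply: cvgM; exact: cvg_enorm.
Qed.

End CoordinatewiseConvergence.

(** * Sets of zero Hausdorff measure *)

Section HausdorffNull.
Context {R : realType} {n : nat}.
Implicit Types (A U : set 'rV[R]_n) (s t : R).

Lemma diam_pow_ge0 s U : (0 <= diam_pow s U)%E.
Proof. by rewrite /diam_pow; case: ifP => // _; exact: poweR_ge0. Qed.

Lemma le_diam U x y : U x -> U y -> ((enorm (x - y))%:E <= diam U)%E.
Proof. by move=> Ux Uy; apply: ereal_sup_ubound; exists x => //; exists y. Qed.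

Lemma diam_ge0 U : U !=set0 -> (0 <= diam U)%E.
Proof. by move=> [x Ux]; have := le_diam _ _ _ Ux Ux; rewrite subrr enorm0. Qed.

Lemma hausdorff_measure_eq0P s A : hausdorff_measure s A = 0%E <->
  forall eta c : R, 0 < eta -> 0 < c -> exists U : nat -> set 'rV[R]_n,
    [/\ A `<=` \bigcup_i U i, forall i, (diam (U i) <= eta%:E)%E &
        (\sum_(0 <= i <oo) diam_pow s (U i) <= c%:E)%E].
Proof.
split=> [H0 eta c eta0 c0|H].
  have : (hausdorff_premeasure s eta A < c%:E)%E.
    apply: (@le_lt_trans _ _ 0%E); last by rewrite lte_fin.
    by rewrite -H0; apply: ereal_sup_ubound; exists eta.
  by move=> /ereal_inf_lt[_ [U [AU Ueta] <-] /ltW Uc]; exists U.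
apply/eqP; rewrite eq_le; apply/andP; split.
  apply: ge_ereal_sup => _ [eta eta0 <-]; apply/lee_addgt0Pr => c c0.
  have [U [AU Ueta Uc]] := H eta c eta0 c0.
  rewrite add0e; apply: ge_ereal_inf.
  by exists (\sum_(0 <= i <oo) diam_pow s (U i))%E => //; exists U.
apply: (@le_trans _ _ (hausdorff_premeasure s 1 A)).
  apply: le_ereal_inf_tmp => _ [U _ <-].
  by apply: nneseries_ge0 => i _ _; exact: diam_pow_ge0.
by apply: ereal_sup_ubound; exists 1 => //=.
Qed.

Lemma hausdorff_measure_set0 s : hausdorff_measure s (set0 : set 'rV[R]_n) = 0%E.
Proof.
apply/hausdorff_measure_eq0P => eta c _ c0; exists (fun=> set0); split=> [x []|i|].
  by apply: ge_ereal_sup => y [z].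
by rewrite eseries0 ?lee_fin ?ltW// => i _ _; rewrite /diam_pow eqxx.
Qed.

(** With covering sets of diameter at most [1], raising the exponent does not increase any term. *)
Lemma hausdorff_measure_eq0_lt {s t A} : t < s -> 0 < s ->
  hausdorff_measure t A = 0%E -> hausdorff_measure s A = 0%E.
Proof.
move=> ts s0 /hausdorff_measure_eq0P H; apply/hausdorff_measure_eq0P.
move=> eta c eta0 c0.
have eta1 : 0 < Num.min eta 1 by rewrite lt_min eta0 ltr01.
have [U [AU Ueta Uc]] := H _ _ eta1 c0.
exists U; split=> // [i|].
  by apply: le_trans (Ueta i) _; rewrite lee_fin ge_min lexx.
apply: le_trans Uc; apply: lee_nneseries => [i _ _|i _]; first exact: diam_pow_ge0.
rewrite /diam_pow; case: ifPn => // /set0P/diam_ge0 d0.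
have : (diam (U i) <= 1%:E)%E.
  by apply: le_trans (Ueta i) _; rewrite lee_fin ge_min lexx orbT.
move: d0; case: (diam (U i)) => [d| |]//.
rewrite lee_fin => d0; rewrite lee_fin => d1.
rewrite !poweR_EFin lee_fin.
have [->|dn0] := eqVneq d 0; first by rewrite powR0 ?gt_eqF// powR_ge0.
by apply: ger_powR (ltW ts); rewrite lt_def dn0 d0.
Qed.

(** The [k]-th set gets a cover of sum at most [c / 2 ^ k.+1]; a bijection between [nat] and pairs
    merges these covers into one sequence. *)
Lemma hausdorff_measure_eq0_bigcup s (A : nat -> set 'rV[R]_n) :
  (forall k, hausdorff_measure s (A k) = 0%E) ->
  hausdorff_measure s (\bigcup_k A k) = 0%E.
Proof.
move=> H; apply/hausdorff_measure_eq0P => eta c eta0 c0.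
have /choice[U UP] k : exists U : nat -> set 'rV[R]_n,
    [/\ A k `<=` \bigcup_i U i, forall i, (diam (U i) <= eta%:E)%E &
      (\sum_(0 <= i <oo) diam_pow s (U i) <= (c / (2 ^ k.+1)%:R)%:E)%E].
  have /hausdorff_measure_eq0P := H k; apply => //.
  by rewrite divr_gt0// ltr0n expn_gt0.
have /card_esym/ppcard_eqP[f] := card_nat2.
exists (fun i => U (f i).1 (f i).2); split.
- move=> x [k _ Akx]; have [Uc _ _] := UP k; have [j _ Ux] := Uc _ Akx.
  have [i _ fi] : [set f i | i in [set: nat]] (k, j) by rewrite image_eq.
  by exists i => //; rewrite fi.
- by move=> i; have [_ + _] := UP (f i).1; apply.
- have d0 k j : (0 <= diam_pow s (U k j))%E by exact: diam_pow_ge0.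
  rewrite nneseries_esumT; last by move=> i; exact: d0.
  rewrite -(@reindex_esum _ _ _ setT setT f
    (fun p => diam_pow s (U p.1 p.2))); last first.
    by have := @bijTT _ _ f; rewrite -setTT_bijective.
  rewrite (_ : setT = setT `*`` (fun=> setT)); last by apply/seteqP; split.
  rewrite -(@esum_esum _ _ _ setT (fun=> setT) (fun k j => diam_pow s (U k j)))//.
  apply: le_trans (epsilon_trick0 xpredT (ltW c0)).
  rewrite nneseries_esumT; last first.
    by move=> k; rewrite lee_fin divr_ge0// ltW.
  apply: le_esum => k _; have [_ _] := UP k.
  by rewrite nneseries_esumT.
Qed.

Lemma le_hausdorff_dim {s A} : 0 < s -> hausdorff_measure s A <> 0%E ->
  (s%:E <= hausdorff_dim A)%E.
Proof.
move=> s0 H; apply: le_ereal_inf_tmp => _ [t [t0 Ht] <-]; rewrite lee_fin leNgt.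
by apply/negP => ts; apply: H; exact: hausdorff_measure_eq0_lt ts s0 Ht.
Qed.

Lemma hausdorff_dim_ge0 A : (0 <= hausdorff_dim A)%E.
Proof. by apply: le_ereal_inf_tmp => _ [t [t0 _] <-]; rewrite lee_fin. Qed.

End HausdorffNull.

(** * Finite ball covers with radii bounded below, and packings *)

Section BallCovers.
Context {R : realType} {n : nat}.
Implicit Types (A : set 'rV[R]_n) (L : seq ('rV[R]_n * R)).

Definition ball_union L : set 'rV[R]_n :=
  [set a | exists2 b, b \in L & eball b.1 b.2 a].

(** The lower bound [lo] turns the budget [v] into a bound on the number of balls, hence on
    packings. *)
Definition ball_coverable (s lo hi v : R) A : Prop :=
  exists L, [/\ A `<=` ball_union L, forall b, b \in L -> lo <= b.2 <= hi &
                \sum_(b <- L) b.2 `^ s <= v].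

Lemma ball_coverable_union s lo hi A L :
  (forall b, b \in L -> ball_coverable s lo hi (b.2 `^ s) (A `&` eball b.1 b.2)) ->
  ball_coverable s lo hi (\sum_(b <- L) b.2 `^ s) (A `&` ball_union L).
Proof.
elim: L => [|b L IH] H.
  by exists [::]; split=> [x []|b|]; rewrite ?big_nil.
have [L1 [c1 b1 s1]] := H b (mem_head _ _).
have [|L2 [c2 b2 s2]] := IH.
  by move=> b' b'L; apply: H; rewrite in_cons b'L orbT.
exists (L1 ++ L2); split.
- move=> x [Ax [b' b'L xb']]; move: b'L; rewrite in_cons => /orP[/eqP bb|b'L].
    have [|d dL xd] := c1 x; first by rewrite -bb.
    by exists d => //; rewrite mem_cat dL.
  have [|d dL xd] := c2 x; first by split=> //; exists b'.
  by exists d => //; rewrite mem_cat dL orbT.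
- by move=> d; rewrite mem_cat => /orP[/b1|/b2].
- by rewrite big_cat big_cons lerD.
Qed.

(** Each refinement at least halves the radii and keeps the budget. A ball is left alone once its
    radius is at most [eps]; a larger one is replaced by balls of radius at least [q * eps]. *)
Lemma ball_coverable_iter {s q} {A} : 0 < q <= 1 ->
  (forall x r, 0 < r ->
     ball_coverable s (q * r) (r / 2) (r `^ s) (A `&` eball x r)) ->
  forall (eps : R) k x r, 0 < eps -> q * eps <= r <= 2 ^+ k * eps ->
    ball_coverable s (q * eps) eps (r `^ s) (A `&` eball x r).
Proof.
move=> /andP[q0 q1] H eps k; elim: k => [|k IH] x r e0 /andP[re1 re2].
  exists [:: (x, r)]; split=> [a [_ xa]|b|]; last by rewrite big_seq1.
    by exists (x, r); rewrite // mem_head.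
  by rewrite inE => /eqP-> /=; rewrite re1; move: re2; rewrite expr0 mul1r.
have [re|er] := leP r eps.
  exists [:: (x, r)]; split=> [a [_ xa]|b|]; last by rewrite big_seq1.
    by exists (x, r); rewrite // mem_head.
  by rewrite inE => /eqP-> /=; rewrite re1.
have r0 : 0 < r by exact: lt_trans er.
have [L [Lc Lb Ls]] := H x r r0.
have [|L' [Lc' Lb' Ls']] := @ball_coverable_union s (q * eps) eps A L.
  move=> b bL; apply: IH => //; have /andP[h1 h2] := Lb b bL.
  apply/andP; split; first by apply: le_trans h1; rewrite ler_pM2l// ltW.
  by apply: le_trans h2 _; rewrite ler_pdivrMr// mulrC mulrA -exprS.
exists L'; split=> //; last exact: le_trans Ls.
by move=> a Aa; apply: Lc'; split; [case: Aa|exact: Lc].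
Qed.

(** A covering ball that contains a packing centre [c i] has its own centre in [eball (c i) eps]. By
    disjointness, distinct packing centres use distinct covering balls, each costing at least
    [lo ^ s]. *)
Lemma packable_le {s lo hi v eps A k} : 0 <= s -> 0 < lo -> hi <= eps ->
  ball_coverable s lo hi v A -> packable A eps k -> k%:R * lo `^ s <= v.
Proof.
move=> s0 lo0 hie [L [Lc Lb Ls]] [c [Ac /trivIsetP ct]].
have /choice[b bP] i : exists b, b \in L /\ eball b.1 b.2 (c i).
  by have [b bL bc] := Lc _ (Ac i); exists b.
have bc i : eball (c i) eps (b i).1.
  have [bL] := bP i; rewrite /eball /closed_ball_ /= enormBC => /le_trans; apply.
  by have /andP[_ /le_trans] := Lb _ bL; apply.
have b_inj : injective b.
  move=> i j bij; apply: contrapT => /eqP ij.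
  have /seteqP[+ _] := ct i j I I ij.
  by move=> /(_ (b i).1); apply; split; [exact: bc|rewrite bij; exact: bc].
have kL : (k <= size L)%N.
  rewrite -[k]card_ord cardE -(size_map b); apply: uniq_leq_size.
    by rewrite map_inj_uniq ?enum_uniq.
  by move=> _ /mapP[i _ ->]; have [] := bP i.
apply: le_trans Ls; apply: (@le_trans _ _ (\sum_(b <- L) lo `^ s)).
  rewrite big_const_seq count_predT iter_addr_0 -[leRHS]mulr_natl.
  by rewrite ler_wpM2r ?powR_ge0// ler_nat.
rewrite big_seq [leRHS]big_seq; apply: ler_sum => d dL.
have /andP[lod _] := Lb d dL.
by apply: ge0_ler_powR => //; rewrite nnegrE ?(ltW lo0)// (le_trans (ltW lo0)).
Qed.

Lemma exists_rich_ball {s q} {A} : 0 < s -> 0 < q <= 1 -> ebounded A ->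
  limf_esup (fun eps : R => (packing_number A eps * (eps `^ s)%:E)%E) 0^'+
    = +oo%E ->
  exists x r, 0 < r /\
    ~ ball_coverable s (q * r) (r / 2) (r `^ s) (A `&` eball x r).
Proof.
move=> s0 q01 [r0 Ar0] sup_oo; apply: contrapT => H.
have {}H x r : 0 < r ->
     ball_coverable s (q * r) (r / 2) (r `^ s) (A `&` eball x r).
  by move=> r_gt0; apply: contrapT => nH; apply: H; exists x, r.
have [q0 q1] := andP q01.
pose r1 := Num.max r0 1.
have r1_gt0 : 0 < r1 by rewrite lt_max ltr01 orbT.
have Ar1 : A `<=` eball 0 r1.
  by move=> a /Ar0 h; apply: le_trans h _; rewrite le_max lexx.
(* Covers with radii in [[q e, e]] and budget [r1 ^ s] give [P(A,e) (q e)^s <= r1^s], that is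
   [P(A,e) e^s <= C]. *)
pose C := r1 `^ s / q `^ s.
have qs0 : 0 < q `^ s by rewrite powR_gt0.
suff : (limf_esup (fun eps : R => (packing_number A eps * (eps `^ s)%:E)%E) 0^'+
    <= C%:E)%E by rewrite sup_oo.
apply: ge_ereal_inf.
exists (ereal_sup [set (packing_number A eps * (eps `^ s)%:E)%E |
    eps in [set eps : R | 0 < eps < r1]]).
  exists [set eps : R | 0 < eps < r1] => //=.
  near=> e; apply/andP; split; near: e; first exact: nbhs_right_gt.
  exact: nbhs_right_lt.
apply: ge_ereal_sup => _ [e /= /andP[e0 er1] <-].
have es0 : 0 < e `^ s by rewrite powR_gt0.
have [k kP] : exists k, r1 <= 2 ^+ k * e.
  exists (Num.bound (r1 / e)); rewrite -ler_pdivrMr//.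
  apply: le_trans (ltW (archi_boundP _)) _; first by rewrite divr_ge0 ?ltW.
  by rewrite -natrX ler_nat ltnW// ltn_expl.
have cov : ball_coverable s (q * e) e (r1 `^ s) A.
  have [|L [Lc Lb Ls]] := @ball_coverable_iter s q A q01 H e k 0 r1 e0.
    by rewrite kP andbT (le_trans _ (ltW er1))// ler_piMl// ltW.
  by exists L; split=> // a Aa; apply: Lc; split=> //; exact: Ar1.
have qe0 : 0 < q * e by rewrite mulr_gt0.
apply: (@le_trans _ _ ((C / e `^ s)%:E * (e `^ s)%:E)%E); last first.
  by rewrite -EFinM divfK// gt_eqF.
apply: lee_wpmul2r; first by rewrite lee_fin ltW.
apply: ge_ereal_sup => _ [m mP <-]; rewrite lee_fin /C.
rewrite -mulrA -invfM -powRM ?(ltW q0) ?(ltW e0)// ler_pdivlMr ?powR_gt0//.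
exact: (packable_le (ltW s0) qe0 (lexx e) cov mP).
Unshelve. all: by end_near. Qed.

End BallCovers.

(** * Limits of rescaled copies of a set *)

Lemma homothetyB {R : realType} {n : nat} (x y y' : 'rV[R]_n) (r : R) :
  x + r *: y - (x + r *: y') = r *: (y - y').
Proof. by rewrite opprD addrACA subrr add0r scalerBr. Qed.

Section TangentSet.
Context {R : realType} {n : nat}.
Context (F : set_system nat) (A : set 'rV[R]_n).
Context (x : nat -> 'rV[R]_n) (r : nat -> R) (r_gt0 : forall m, 0 < r m).

(** A Kuratowski-type limit of the blow-ups [(A - x m) / r m]. They are not cut to the unit ball:
    boundedness is imposed only on the sequence chosen for the measure bound. *)
Definition tangent_set : set 'rV[R]_n :=
  [set p | exists2 f : nat -> 'rV[R]_n,
    forall m, A (x m + r m *: f m) & coord_cvg F f p].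

(** Distinctness of three points and membership of their angle in an open interval are open
    conditions, so they already hold for approximating points at some index [m], and a similarity
    carries these into [A]. *)
Lemma tangent_set_avoids (alpha delta : R) : ProperFilter F ->
  avoids_angles A alpha delta -> avoids_angles tangent_set alpha delta.
Proof.
move=> FF avA a aI [p [p' [p'' [[[f Af fp] [f' Af' fp'] [f'' Af'' fp'']]]]]].
move=> [[/eqP pp' /eqP pp'' /eqP p'p''] ea].
have near_neq (g g' : nat -> 'rV[R]_n) y y' :
    coord_cvg F g y -> coord_cvg F g' y' -> y != y' ->
    \forall m \near F, g m <> g' m.
  move=> gy gy' yy'.
  have d0 : 0 < enorm (y - y') by apply: enorm_gt0; apply/eqP; rewrite subr_eq0.
  have : \forall m \near F, 0 < enorm (g m - g' m).
    exact: (cvgr_gt _ (cvg_enorm _ (coord_cvgB _ gy gy')) _ d0).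
  by apply: filterS => m + gg; rewrite gg subrr enorm0 ltxx.
have near_angle : \forall m \near F,
    alpha - delta < angle (f' m - f m) (f'' m - f m) < alpha + delta.
  apply: (angle_near F (fun m => f' m - f m) _ _ _ _ _ _ _
    (coord_cvgB _ fp' fp) (coord_cvgB _ fp'' fp)).
  - by apply/eqP; rewrite subr_eq0 eq_sym.
  - by apply/eqP; rewrite subr_eq0 eq_sym.
  - by rewrite ea.
have [m [[ff' [ff'' f'f'']] am]] := filter_ex (filterI (filterI
  (near_neq _ _ _ _ fp fp' pp') (filterI
  (near_neq _ _ _ _ fp fp'' pp'') (near_neq _ _ _ _ fp' fp'' p'p''))) near_angle).
apply: (avA _ am).
have sim_inj (y y' : 'rV[R]_n) : y <> y' -> x m + r m *: y <> x m + r m *: y'.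
  by move=> yy' /addrI/(scalerI (lt0r_neq0 (r_gt0 m))).
exists (x m + r m *: f m), (x m + r m *: f' m), (x m + r m *: f'' m).
split; [by split|split; first by split; exact: sim_inj].
by rewrite !homothetyB angleZ.
Qed.

Lemma tangent_set_hausdorff_gt0 (s : R) : UltraFilter F -> \oo `<=` F -> 0 < s ->
  (forall m, ~ ball_coverable s (m.+1%:R^-1 * r m) (r m / 2) (r m `^ s)
     (A `&` eball (x m) (r m))) ->
  hausdorff_measure s tangent_set <> 0%E.
Proof.
move=> UF ooF s0 rich /hausdorff_measure_eq0P H.
(* Half of the budget [2^-1 ^ s] is for the diameters, half for the enlargements [e i]. This total
   forces every radius below [1/2] and the sum below [1]. *)
pose kap : R := 2^-1 `^ s / 2.
have half0 : (0 : R) < 2^-1 `^ s by rewrite powR_gt0.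
have kap0 : 0 < kap by rewrite divr_gt0.
have [U [KU _ Us]] := H 1 kap ltr01 kap0.
have partial N : (\sum_(0 <= i < N) diam_pow s (U i) <= kap%:E)%E.
  apply: le_trans Us; apply: nneseries_lim_ge => i _ _; exact: diam_pow_ge0.
have wfin i : diam_pow s (U i) \is a fin_num.
  rewrite ge0_fin_numE ?diam_pow_ge0//.
  apply: (@le_lt_trans _ _ kap%:E); last by rewrite ltry.
  apply: le_trans (partial i.+1); rewrite big_nat_recr//= leeDr//.
  by apply: sume_ge0 => j _; exact: diam_pow_ge0.
pose w i := fine (diam_pow s (U i)).
have w0 i : 0 <= w i by exact/fine_ge0/diam_pow_ge0.
pose e i : R := kap / (2 ^ i.+1)%:R.
have e0 i : 0 < e i by rewrite divr_gt0// ltr0n expn_gt0.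
have we0 i : 0 < w i + e i by rewrite ltr_wpDl.
(* Adding [e i] makes each radius exceed [diam (U i)] strictly, so that the
   balls are open neighbourhoods of their share of the cover. *)
pose rho i := (w i + e i) `^ s^-1.
have rho0 i : 0 < rho i by rewrite powR_gt0.
have rhos i : rho i `^ s = w i + e i.
  by rewrite /rho -powRrM mulVf ?gt_eqF// powRr1// ltW.
have sumrho N : \sum_(0 <= i < N) rho i `^ s <= 2^-1 `^ s.
  rewrite (eq_bigr _ (fun i _ => rhos i)) big_split/= [leRHS]splitr; apply: lerD.
    rewrite -lee_fin -sumEFin; apply: le_trans (partial N).
    by apply: lee_sum => i _; rewrite fineK.
  rewrite -lee_fin -sumEFin; apply: le_trans (epsilon_trick0 xpredT (ltW kap0)).
  by apply: nneseries_lim_ge => i _ _; rewrite lee_fin ltW//; exact: e0.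
have rho_half i : rho i <= 2^-1.
  have : rho i `^ s <= 2^-1 `^ s.
    apply: le_trans (sumrho i.+1); rewrite big_nat_recr//= lerDr.
    by apply: sumr_ge0 => j _; exact: powR_ge0.
  apply: contraTT; rewrite -!ltNge => h.
  by apply: gt0_ltr_powR; rewrite ?nnegrE// ltW.
(* Any point of [U i] serves as centre, since [U i] lies within its diameter of it; an empty [U i]
   gets [0]. *)
have /choice[y yP] i : exists y, forall p, U i p -> enorm (y - p) < rho i.
  have [[y Uy]|U0] := pselect (U i !=set0); last first.
    by exists 0 => p Up; exfalso; apply: U0; exists p.
  exists y => p Up; have : enorm (y - p) `^ s < rho i `^ s.
    rewrite rhos; apply: (@le_lt_trans _ _ (w i)); last by rewrite ltrDl.
    rewrite -lee_fin fineK// /diam_pow; case: ifPn => [/eqP U0|_].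
      by move: Uy; rewrite U0.
    rewrite -poweR_EFin; apply: gt0_ler_poweR (ltW s0) _ _ _ _ _.
    - by rewrite in_itv/= leey lee_fin enorm_ge0.
    - by rewrite in_itv/= leey andbT; apply: diam_ge0; exists y.
    - exact: le_diam.
  apply: contraTT; rewrite -!leNgt => h.
  apply: ge0_ler_powR => //; rewrite ?nnegrE ?enorm_ge0 ?(ltW s0)//.
  exact: (ltW (rho0 i)).
(* If there were no such point, the balls with index below [m] and radius at least [1/(m+1)], scaled
   back by [r m], would form a cover excluded by [rich m]. *)
have /choice[f fP] m : exists f, [/\ A (x m + r m *: f), enorm f <= 1 &
    forall i, (i < m)%N -> m.+1%:R^-1 <= rho i -> rho i <= enorm (y i - f)].
  apply: contrapT => nf; apply: (rich m).
  exists [seq (x m + r m *: y i, r m * rho i) |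
    i <- index_iota 0 m & m.+1%:R^-1 <= rho i].
  split.
  - move=> a [Aa ax].
    pose g := (r m)^-1 *: (a - x m).
    have ag : a = x m + r m *: g.
      by rewrite scalerA divff ?gt_eqF// scale1r addrC subrK.
    apply: contrapT => na; apply: nf; exists g; split; first by rewrite -ag.
      rewrite enormZ ?invr_ge0 ?(ltW (r_gt0 m))// mulrC ler_pdivrMr// mul1r enormBC.
      exact: ax.
    move=> i im qi; rewrite leNgt; apply/negP => yg; apply: na.
    exists (x m + r m *: y i, r m * rho i).
      by apply/mapP; exists i => //; rewrite mem_filter qi mem_index_iota.
    rewrite /eball /closed_ball_ /= {1}ag homothetyB enormZ ?(ltW (r_gt0 m))//.
    by rewrite ler_pM2l// ltW.
  - move=> b /mapP[i]; rewrite mem_filter => /andP[qi _] -> /=.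
    by rewrite mulrC !ler_pM2l// qi rho_half.
  - rewrite big_map/= big_filter.
    apply: (@le_trans _ _ (\sum_(0 <= i < m) r m `^ s * rho i `^ s)).
      rewrite big_mkcond/=; apply: ler_sum => i _.
      by case: ifP => _; [rewrite powRM// ltW|rewrite mulr_ge0 ?powR_ge0].
    rewrite -mulr_sumr ler_piMr ?powR_ge0//.
    apply: le_trans (sumrho m) _.
    apply: (@le_trans _ _ (2^-1 `^ 0)); last by rewrite powRr0.
    by apply: ger_powR (ltW s0); rewrite invr_gt0 invf_le1 ?ltr0n// ler1n.
have [p fp] : exists p, coord_cvg F f p.
  by apply: (coord_cvg_ultra F f 1) => // m; have [] := fP m.
have [|i _ Uip] := KU p; first by exists f => // m; have [] := fP m.
(* The limit [p] is strictly inside ball [i], hence so is [f m] for [F]-most [m]; but for large [m]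
   ball [i] is among those that [f m] avoids. *)
have nc : \forall m \near F, enorm (y i - f m) < rho i.
  have cyf : coord_cvg F (fun m => y i - f m) (y i - p).
    exact: (coord_cvgB _ (coord_cvg_cst _ (y i)) fp).
  exact: (cvgr_lt _ (cvg_enorm _ cyf) _ (yP _ _ Uip)).
have big : \forall m \near F, (i < m)%N by apply: ooF; exact: nbhs_infty_gt.
have fine_scale : \forall m \near F, (m.+1%:R^-1 : R) < rho i.
  by apply: ooF; exact: (near_infty_natSinv_lt (PosNum (rho0 i))).
have [m [[mi im] qi]] := filter_ex (filterI (filterI nc big) fine_scale).
have [_ _ /(_ i im (ltW qi))] := fP m.
by rewrite leNgt mi.
Qed.

End TangentSet.

(** * From maximal packings to Hausdorff covers *)

Section MinkowskiCover.
Context {R : realType} {n : nat}.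
Implicit Types (A : set 'rV[R]_n).

Lemma diam_eball_le x (r : R) : (diam (eball x r : set 'rV[R]_n) <= (r + r)%:E)%E.
Proof.
apply: ge_ereal_sup => _ [y xy [z xz <-]]; rewrite lee_fin.
have -> : y - z = (y - x) + (x - z) by rewrite addrA subrK.
by apply: le_trans (enormD _ _) _; rewrite enormBC lerD.
Qed.

(** A point of [A] farther than [2 eps] from all centres would be the centre of one more disjoint
    ball. *)
Lemma maximal_packing_covers {A} {eps : R} {k} {c : 'I_k -> 'rV[R]_n} :
  ~ packable A eps k.+1 -> (forall i, A (c i)) ->
  trivIset setT (fun i => eball (c i) eps) ->
  A `<=` [set a | exists i, eball (c i) (eps + eps) a].
Proof.
move=> kmax Ac /trivIsetP ct a Aa; apply: contrapT => na; apply: kmax.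
have disj i : eball (c i) eps `&` eball a eps = set0.
  apply/seteqP; split=> // z [cz az]; apply: na; exists i.
  rewrite /eball /closed_ball_ /=.
  have -> : c i - a = (c i - z) + (z - a) by rewrite addrA subrK.
  by apply: le_trans (enormD _ _) _; rewrite lerD// enormBC.
(* The new centre [a] takes the last index [ord_max]; the others keep their [c j]. *)
exists (fun i => if unlift ord_max i is Some j then c j else a); split.
  by move=> i; case: (unlift _ _).
apply/trivIsetP => i j _ _.
case: unliftP => [i' ->|->]; case: unliftP => [j' ->|->] //.
- by move=> ij; apply: ct => //; apply: contraNN ij => /eqP->.
- by rewrite setIC.
- by rewrite eqxx.
Qed.

(** If [P(A,e) e^s <= C] for small [e], a maximal packing yields [P(A,e)] covering sets of diameter
    at most [4 e], with sum at most [4^t C e^(t-s)], which tends to [0]. *)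
Lemma hausdorff_measure_eq0_packing A (s t : R) : s < t -> 0 < t ->
  limf_esup (fun eps : R => (packing_number A eps * (eps `^ s)%:E)%E) 0^'+
    <> +oo%E ->
  hausdorff_measure t A = 0%E.
Proof.
move=> st t0 /eqP; rewrite -ltey => /ereal_inf_lt[_ [V V0 <-]].
set S := ereal_sup _ => Soo.
(* The bound is raised to at least [0] for the Archimedean bound on packing sizes. *)
have [C C0 SC] : exists2 C : R, 0 <= C & (S <= C%:E)%E.
  case: S Soo => [S'| |]// _; last by exists 0; rewrite ?leNye.
  by exists (Num.max S' 0); rewrite ?le_max ?lexx ?orbT// lee_fin le_max lexx.
apply/hausdorff_measure_eq0P => eta c eta0 c0.
have near_small : \forall e \near 0^'+, (4 `^ t * C) * e `^ (t - s) < c.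
  have : (4 `^ t * C) * e `^ (t - s) @[e --> 0^'+] --> (4 `^ t * C) * (0 : R).
    by apply: cvgMr; apply: powR_cvg0; rewrite subr_gt0.
  by rewrite mulr0 => /(cvgr_lt _); apply.
have eta4 : 0 < eta / 4 by rewrite divr_gt0.
have [e [[[Ve e0] eeta] ec]] := filter_ex (filterI (filterI (filterI V0
  (nbhs_right_gt 0)) (nbhs_right_lt eta4)) near_small).
move: e0 eeta ec => /= e0 eeta ec.
have es0 : 0 < e `^ s by rewrite powR_gt0.
have kC k : packable A e k -> k%:R * e `^ s <= C.
  move=> pk; rewrite -lee_fin; apply: le_trans SC.
  apply: (@le_trans _ _ (packing_number A e * (e `^ s)%:E)%E); last first.
    by rewrite /S; apply: ereal_sup_ubound; exists e.
  rewrite EFinM; apply: lee_wpmul2r; first by rewrite lee_fin ltW.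
  by apply: ereal_sup_ubound; exists k.
have ex0 : exists k, `[< packable A e k >].
  exists 0%N; apply/asboolP; exists (fun=> 0); split; first by case.
  by apply/trivIsetP; case.
have bnd k : `[< packable A e k >] -> (k <= Num.bound (C / e `^ s))%N.
  move=> /asboolP/kC; rewrite -ler_pdivlMr// => h.
  by rewrite -(@ler_nat R) (le_trans h)// ltW// archi_boundP// divr_ge0// ltW.
have [k /asboolP kP kmax] := ex_maxnP ex0 bnd.
have nk : ~ packable A e k.+1.
  by move=> /asboolP/kmax; rewrite ltnn.
have [ctr [Actr tctr]] := kP.
have cov := maximal_packing_covers nk Actr tctr.
(* The finite cover is padded with empty sets, whose [diam_pow] is [0]. *)
pose U i := if insub i is Some j then eball (ctr j) (e + e) else set0.
have dU i : (diam (U i) <= (4 * e)%:E)%E.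
  rewrite /U; case: insubP => [j _ _|_].
    apply: le_trans (diam_eball_le _ _) _; rewrite lee_fin; lra.
  by apply: ge_ereal_sup => y [z].
have e4 : 0 <= 4 * e by rewrite mulr_ge0// ltW.
have dpU i : (diam_pow t (U i) <= ((4 * e) `^ t)%:E)%E.
  rewrite /diam_pow; case: ifPn => [_|/set0P U0]; first by rewrite lee_fin powR_ge0.
  rewrite -poweR_EFin; apply: gt0_ler_poweR (ltW t0) _ _ _ _ (dU i).
    by rewrite in_itv/= leey diam_ge0.
  by rewrite in_itv/= leey lee_fin e4.
exists U; split.
- by move=> a /cov[i ai]; exists (val i) => //; rewrite /U valK.
- move=> i; apply: le_trans (dU i) _; rewrite lee_fin.
  by move: eeta; rewrite ltr_pdivlMr// mulrC => /ltW.
- rewrite (nneseries_split 0 k); last by move=> i _; exact: diam_pow_ge0.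
  rewrite add0n [X in (_ + X)%E]eseries0; last first.
    by move=> i ki _; rewrite /U insubF /diam_pow ?eqxx// ltnNge ki.
  rewrite adde0; apply: (@le_trans _ _ (\sum_(0 <= i < k) ((4 * e) `^ t)%:E)%E).
    by apply: lee_sum => i _; exact: dpU.
  rewrite sumEFin lee_fin big_const_nat subn0 iter_addr_0 -[leLHS]mulr_natl.
  apply: le_trans (ltW ec).
  rewrite powRM ?(ltW e0)// mulrCA -mulrA ler_pM2l ?powR_gt0//.
  have -> : e `^ t = e `^ s * e `^ (t - s).
    by rewrite -powRD ?gt_eqF ?implybT// addrC subrK.
  by rewrite mulrA ler_wpM2r ?powR_ge0// kC.
Qed.

End MinkowskiCover.

(** * The two inequalities between the suprema *)

Lemma upper_minkowski_dim_le_Ctilde {R : realType} {n : nat} {alpha delta : R}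
    {A : set 'rV[R]_n} : ebounded A -> avoids_angles A alpha delta ->
  (upper_minkowski_dim A <= Ctilde alpha delta)%E.
Proof.
move=> bA avA; apply: ge_ereal_sup => _ [s sup_oo <-].
(* A nonpositive [s] is below the Hausdorff dimension of [A] itself; only a positive [s] calls for a
   blow-up. *)
have [s0|s0] := leP s 0.
  apply: (@le_trans _ _ (hausdorff_dim A)).
    by apply: le_trans (hausdorff_dim_ge0 A); rewrite lee_fin.
  by apply: ereal_sup_ubound; exists n, A.
(* The ratio [1/(m+1)] tends to [0], so that in the limit no positive radius is excluded from the
   covers. *)
have rich m : exists xr : 'rV[R]_n * R, 0 < xr.2 /\
    ~ ball_coverable s (m.+1%:R^-1 * xr.2) (xr.2 / 2) (xr.2 `^ s)
      (A `&` eball xr.1 xr.2).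
  have q01 : 0 < (m.+1%:R^-1 : R) <= 1.
    by rewrite invr_gt0 ltr0n/= invf_le1 ?ltr0n// ler1n.
  by have [x [r [r0 nc]]] := exists_rich_ball s0 q01 bA sup_oo; exists (x, r).
have [xr xrP] := choice rich.
have [F [UF ooF]] := ultraFilterLemma (T := nat) (F := \oo) _.
pose K := tangent_set F A (fun m => (xr m).1) (fun m => (xr m).2).
have r0 m : 0 < (xr m).2 by have [] := xrP m.
apply: (@le_trans _ _ (hausdorff_dim K)).
  apply: le_hausdorff_dim => //; apply: tangent_set_hausdorff_gt0 => // m.
  by have [] := xrP m.
apply: ereal_sup_ubound; exists n, K; split=> //.
exact: tangent_set_avoids.
Qed.

(** One ball can always be packed, so [P(A,e) e^(-s) >= e^(-s)] is unbounded for every [s > 0]. *)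
Lemma upper_minkowski_dim_ge0 {R : realType} {n : nat} {A : set 'rV[R]_n} :
  A !=set0 -> (0 <= upper_minkowski_dim A)%E.
Proof.
move=> [x Ax]; apply/lee_subgt0Pr => s s0; rewrite sub0e.
apply: ereal_sup_ubound; exists (- s) => //=.
apply/eqyP => C C0; apply: le_ereal_inf_tmp => _ [V V0 <-].
have near_small : \forall e \near 0^'+, e `^ s < C^-1.
  by apply: (cvgr_lt _ (powR_cvg0 s0)); rewrite invr_gt0.
have [e [[Ve e0] es]] :=
  filter_ex (filterI (filterI V0 (nbhs_right_gt 0)) near_small).
apply: (@le_trans _ _ (packing_number A e * (e `^ (- s))%:E)%E); last first.
  by apply: ereal_sup_ubound; exists e.
apply: (@le_trans _ _ (1%:E * (e `^ (- s))%:E)%E).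
  rewrite mul1e lee_fin powRN ltW// -[ltLHS]invrK.
  by rewrite ltf_pV2// posrE ?invr_gt0// powR_gt0.
apply: lee_wpmul2r; first by rewrite lee_fin powR_ge0.
apply: ereal_sup_ubound; exists 1%N => //; exists (fun=> x); split=> //.
by apply/trivIsetP => i j _ _; rewrite !ord1 eqxx.
Qed.

Lemma avoids_anglesS {R : realType} {n : nat} {A B : set 'rV[R]_n}
    {alpha delta : R} :
  A `<=` B -> avoids_angles B alpha delta -> avoids_angles A alpha delta.
Proof.
move=> AB avB a /avB nB [x [y [z [[Ax Ay Az] xyz]]]]; apply: nB.
by exists x, y, z; split=> //; split; exact: AB.
Qed.

Theorem corollary5p7 (R : realType) (alpha delta : R)
    (halpha : 0 <= alpha <= pi) (hdelta : 0 < delta) :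
  Ctilde alpha delta =
  ereal_sup [set d | exists (n : nat) (A : set 'rV[R]_n),
    [/\ A !=set0, ebounded A, avoids_angles A alpha delta
      & d = upper_minkowski_dim A]].
Proof.
apply/eqP; rewrite eq_le; apply/andP; split; last first.
  apply: ge_ereal_sup => _ [n [A [_ bA avA ->]]].
  exact: upper_minkowski_dim_le_Ctilde.
set S := ereal_sup _.
(* A single point witnesses this; it makes [S + e] an admissible exponent for [hausdorff_dim]. *)
have S0 : (0 <= S)%E.
  have p0 : [set (0 : 'rV[R]_0)] !=set0 by exists 0.
  apply: le_trans (upper_minkowski_dim_ge0 p0) _.
  apply: ereal_sup_ubound; exists 0%N, [set 0]; split=> //.
  - by exists 0 => _ ->; rewrite /eball /closed_ball_ /= subrr enorm0.
  - by move=> a _ [x [y [z [[-> -> _] [[]]]]]].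
apply: ge_ereal_sup => _ [n [A [avA ->]]].
have SP (B : set 'rV[R]_n) : B !=set0 -> ebounded B -> B `<=` A ->
    (upper_minkowski_dim B <= S)%E.
  move=> B0 bB BA; apply: ereal_sup_ubound; exists n, B; split=> //.
  exact: avoids_anglesS avA.
case: S S0 SP => [S| |]//; last by move=> _ _; exact: leey.
rewrite lee_fin => S0 SP; apply/lee_addgt0Pr => e e0.
rewrite -EFinD; apply: ereal_inf_lbound; exists (S + e) => //.
split; first by rewrite addr_ge0// ltW.
have -> : A = \bigcup_(k : nat) (A `&` eball 0 k%:R).
  apply/seteqP; split=> [a Aa|a [k _ []]//].
  exists (Num.bound (enorm (0 - a))) => //; split=> //.
  exact/ltW/archi_boundP/enorm_ge0.
apply: hausdorff_measure_eq0_bigcup => k.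
(* The supremum [S] ranges over nonempty sets, so an empty piece is treated apart. *)
have [->|/set0P B0] := eqVneq (A `&` eball 0 k%:R) set0.
  exact: hausdorff_measure_set0.
(* The exponent [S + e / 2] leaves room on both sides: it is below [S + e], and an infinite limsup
   there would put the Minkowski dimension of the piece above [S]. *)
apply: (@hausdorff_measure_eq0_packing _ _ _ (S + e / 2)).
- by rewrite ltrD2l ltr_pdivrMr// mulr_natr mulr2n ltrDl.
- by rewrite ltr_wpDl.
move=> sup_oo.
have bB : ebounded (A `&` eball 0 k%:R) by exists k%:R => a [].
have := SP _ B0 bB (@subIsetl _ _ _); apply/negP; rewrite -ltNge.
apply: (@lt_le_trans _ _ (S + e / 2)%:E); first by rewrite lte_fin ltrDl divr_gt0.
by apply: ereal_sup_ubound; exists (S + e / 2).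
Qed.
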